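(* Let $K\in\mathbb{R}^{m\times n}$ be such that $KK^*\in\mathbb{R}^{m\times m}$ is diagonally dominant, let $J(u)=\|Ku\|_1$ on $\mathbb{R}^n$, and let $f\in\mathbb{R}^n$. Denote $\tau=\frac1t$, $v(\tau)=u_{GF}(1/\tau)=u_{GF}(t)$ and $r(\tau)=p_{VM}(1/\tau)=p_{VM}(t)$. Then $$\partial_\tau r(\tau)=f-\partial_\tau\big(\tau\,v(\tau)\big),\qquad r(\tau)\in\partial J\big(\partial_\tau(\tau\,v(\tau))\big)$$ for all $\tau>0$ except the finitely many at which $v$ is not differentiable; in other words, $\big(r(\tau),\partial_\tau(\tau\,v(\tau))\big)$ solves the inverse scale space flow $\partial_sq_{IS}(s)=f-v_{IS}(s)$, $q_{IS}(s)\in\partial J(v_{IS}(s))$, $q_{IS}(0)=0$ (with $q_{IS}=r$, $v_{IS}=\partial_\tau(\tau v)$, $s=\tau$).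
   Context: $\partial J$ is the convex subdifferential, $\|\cdot\|$ the Euclidean norm, $K^*$ the transpose of $K$. A matrix $A$ is diagonally dominant if $|A_{ll}|\ge\sum_{j\ne l}|A_{lj}|$ for every $l$. Gradient flow: $\partial_tu_{GF}(t)=-p_{GF}(t)$, $p_{GF}(t)\in\partial J(u_{GF}(t))$ for a.e. $t>0$, $u_{GF}(0)=f$; $u_{GF}$ is piecewise affine in $t$ with finitely many pieces. Variational method: $u_{VM}(t)=\arg\min_u\frac12\|u-f\|^2+tJ(u)$ for $t>0$, and $p_{VM}(t)=(f-u_{VM}(t))/t\in\partial J(u_{VM}(t))$. The initial condition $q_{IS}(0)=0$ for $r$ is understood as $\lim_{\tau\to0^+}r(\tau)=0$. *)

(* Defs.v *)
From mathcomp Require Import all_boot all_order all_algebra.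
From mathcomp Require Import all_classical all_reals all_analysis.

Set Implicit Arguments.
Unset Strict Implicit.
Unset Printing Implicit Defensive.

Import Order.TTheory GRing.Theory Num.Theory.
Import numFieldNormedType.Exports.

Local Open Scope classical_set_scope.
Local Open Scope ring_scope.

Definition dot (R : realType) (n : nat) (x y : 'cV[R]_n) : R :=
  \sum_(i < n) x i 0 * y i 0.

(* The library norm `|x| on 'cV[R]_n is the sup norm; it only serves to define
   limits and derivatives. *)
Definition enorm (R : realType) (n : nat) (x : 'cV[R]_n) : R :=
  Num.sqrt (\sum_(i < n) x i 0 ^+ 2).

Definition l1norm (R : realType) (m : nat) (y : 'cV[R]_m) : R :=
  \sum_(i < m) `|y i 0|.

Definition diagonally_dominant (R : realType) (m : nat) (A : 'M[R]_m) : Prop :=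
  forall l : 'I_m, \sum_(j < m | j != l) `|A l j| <= `|A l l|.

Definition subdifferential (R : realType) (n : nat) (J : 'cV[R]_n -> R)
    (u : 'cV[R]_n) : set 'cV[R]_n :=
  [set p | forall w, J u + dot p (w - u) <= J w].

(* The pieces are closed intervals, so that a piecewise affine function is
   continuous on [0, +oo[; the last piece is unbounded because b is
   arbitrary. *)
Definition piecewise_affine (R : realType) (n : nat) (u : R -> 'cV[R]_n) :
    Prop :=
  exists breaks : seq R, forall a b : R, 0 <= a -> a < b ->
    (forall x, x \in breaks -> x \notin `]a, b[) ->
    exists c d : 'cV[R]_n, forall t, t \in `[a, b] -> u t = c + t *: d.

Definition gradient_flow (R : realType) (n : nat) (J : 'cV[R]_n -> R)
    (f : 'cV[R]_n) (u p : R -> 'cV[R]_n) : Prop :=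
  [/\ piecewise_affine u,
      u 0 = f &
      {ae (@lebesgue_measure R), forall t : R, 0 < t ->
        is_derive t 1 u (- p t) /\ subdifferential J (u t) (p t)}].

Definition vm_energy (R : realType) (n : nat) (J : 'cV[R]_n -> R)
    (f : 'cV[R]_n) (t : R) (u : 'cV[R]_n) : R :=
  2^-1 * enorm (u - f) ^+ 2 + t * J u.

Definition variational_method (R : realType) (n : nat) (J : 'cV[R]_n -> R)
    (f : 'cV[R]_n) (u : R -> 'cV[R]_n) : Prop :=
  forall t, 0 < t -> forall w, vm_energy J f t (u t) <= vm_energy J f t w.

(* The equations hold outside a finite set D of times, at which q is still
   continuous; q 0 itself is not constrained, only the limit at 0^+. *)
Definition inverse_scale_space_flow (R : realType) (n : nat)
    (J : 'cV[R]_n -> R) (f : 'cV[R]_n) (D : set R) (q v : R -> 'cV[R]_n) :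
    Prop :=
  [/\ finite_set D,
      (forall s : R, 0 < s -> {for s, continuous q}),
      q s @[s --> 0^'+] --> (0 : 'cV[R]_n) &
      forall s : R, 0 < s -> ~ D s ->
        is_derive s 1 q (f - v s) /\ subdifferential J (v s) (q s)].

(* Main.v *)
Require Import Defs.
From mathcomp Require Import all_boot all_order all_algebra.
From mathcomp Require Import all_classical all_reals all_analysis.
From mathcomp Require Import ring lra.

Set Implicit Arguments.
Unset Strict Implicit.
Unset Printing Implicit Defensive.

Import Order.TTheory GRing.Theory Num.Theory.
Import numFieldNormedType.Exports.

Local Open Scope classical_set_scope.
Local Open Scope ring_scope.

(** Why the theorem holds.

    The only use of diagonal dominance is the sign condition
    [(K u)_l (K p)_l >= 0] for every [p] in the subdifferential of [J] at [u]
    ([subdifferential_sign_descent]): moving [u] a little against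
    [(K u)_l K^T e_l] decreases [|(K u)_l|] by at least as much as it can
    increase the other entries of [K u], so [J] does not increase, and the
    subgradient inequality gives the sign.

    On an interval [[a, b]] without breaks the gradient flow is [c + t d] with
    [- d] a subgradient at its right end ([gradient_flow_piece]).  By the sign
    condition no entry of [K (c + t d)] changes sign or moves away from zero as
    [t] increases.  Since [J] is the 1-norm of [K u], it is then additive on the
    decompositions [u a = u b + (u a - u b)] and, for [0 < t < b],
    [b u t = (b - t) c + t (u b)].  For a sublinear functional, a subgradient
    at a sum on which the functional is additive is a subgradient at each
    summand ([subdifferential_summand]).  The two decompositions thus yield:
    - subgradients at [u a] remain subgradients at [u b]
      ([subdifferential_nested]);
    - subgradients at [u t] are subgradients at the intercept [c] of the piece
      to the right of [t] ([subdifferential_intercept]).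

    Chaining the first fact over the pieces, the mean of the flow velocity,
    [(f - u t) / t], is a convex combination of subgradients at [u t]
    ([flow_average]).  This is the optimality condition of the variational
    problem, whose minimiser is unique, so both methods have the same solution
    and [r tau = tau (f - v tau)]; the differential equation follows.  To the
    left of [tau] one has [tau v tau = tau c + d] with [c], [d] taken from the
    piece to the right of [t = 1 / tau], so the derivative of [tau v tau] is
    the intercept [c], and the second fact is the required inclusion.

    Subgradients of [J] are uniformly bounded, so the flow is Lipschitz and [r]
    is continuous; the optimality condition forces [|u t| <= |f|], so
    [r tau = tau (f - v tau)] tends to 0 with [tau]. *)

(** * Euclidean inner product *)

Section Dot.
Context {R : realType} {n : nat}.
Implicit Types x y z : 'cV[R]_n.

Lemma dotC x y : dot x y = dot y x.
Proof. by apply: eq_bigr => i _; rewrite mulrC. Qed.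

Lemma dotDl x y z : dot (x + y) z = dot x z + dot y z.
Proof. by rewrite -big_split; apply: eq_bigr => i _; rewrite mxE mulrDl. Qed.

Lemma dotZl a x y : dot (a *: x) y = a * dot x y.
Proof. by rewrite mulr_sumr; apply: eq_bigr => i _; rewrite mxE mulrA. Qed.

Lemma dotNl x y : dot (- x) y = - dot x y.
Proof. by rewrite -scaleN1r dotZl mulN1r. Qed.

Lemma dotDr x y z : dot x (y + z) = dot x y + dot x z.
Proof. by rewrite dotC dotDl !(dotC x). Qed.

Lemma dotZr a x y : dot x (a *: y) = a * dot x y.
Proof. by rewrite dotC dotZl (dotC x). Qed.

Lemma dotNr x y : dot x (- y) = - dot x y.
Proof. by rewrite dotC dotNl (dotC x). Qed.

Lemma sqr_entry_le_dot x i : x i 0 ^+ 2 <= dot x x.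
Proof.
rewrite /dot (bigD1 i)//= -expr2 lerDl.
by apply: sumr_ge0 => j _; rewrite -expr2 sqr_ge0.
Qed.

Lemma dot_ge0 x : 0 <= dot x x.
Proof. by apply: sumr_ge0 => i _; rewrite -expr2 sqr_ge0. Qed.

Lemma dot_le0 x : dot x x <= 0 -> x = 0.
Proof.
move=> x0; apply/matrixP => i j; rewrite ord1 mxE; apply/eqP.
by rewrite -sqrf_eq0 eq_le sqr_ge0 (le_trans (sqr_entry_le_dot x i)).
Qed.

Lemma enorm_sqr x : enorm x ^+ 2 = dot x x.
Proof.
rewrite sqr_sqrtr; first by apply: eq_bigr => i _; rewrite expr2.
by apply: sumr_ge0 => i _; exact: sqr_ge0.
Qed.

End Dot.

(** * Subgradients of convex and of sublinear functionals *)

Section Subdifferential.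
Context {R : realType} {n : nat} (J : 'cV[R]_n -> R).
Implicit Types p q u x y : 'cV[R]_n.

Lemma subdifferential_convex u p q a : 0 <= a <= 1 ->
  subdifferential J u p -> subdifferential J u q ->
  subdifferential J u (a *: p + (1 - a) *: q).
Proof.
move=> /andP[a0 a1] up uq w; move: (up w) (uq w).
rewrite dotDl !dotZl; nra.
Qed.

(** The energy is strongly convex: it grows by at least half the squared
    distance away from a point satisfying the optimality condition. *)
Lemma proximal_point_unique f u w t : 0 < t ->
  subdifferential J u (t^-1 *: (f - u)) ->
  vm_energy J f t w <= vm_energy J f t u -> w = u.
Proof.
move=> t0 /(_ w); rewrite /vm_energy !enorm_sqr dotZl => up ew.
apply/eqP; rewrite -subr_eq0; apply/eqP/dot_le0.
have {}up : t * J u + dot (f - u) (w - u) <= t * J w.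
  by rewrite -(ler_pM2l t0) mulrDr mulrA mulfV ?gt_eqF// mul1r in up.
move: ew up; rewrite -(subrKA u w (- f)) -[u - f]opprB.
move: (w - u) (f - u) => x y.
rewrite !dotDl !dotDr !dotNl !dotNr (dotC y).
by have := dot_ge0 x; lra.
Qed.

Hypothesis homJ : forall a u, 0 <= a -> J (a *: u) = a * J u.

(** Euler's identity: testing with [0] and [2 u] pins down [dot p u].  The
    bound that remains does not depend on [u]; this is what lets a subgradient
    be carried from one point to another. *)
Lemma subdifferential_homP u p :
  subdifferential J u p <-> dot p u = J u /\ forall w, dot p w <= J w.
Proof.
split=> [up|[pu pw] w]; last first.
  by rewrite dotDr dotNr pu addrC subrK.
have J0 : J 0 = 0 by rewrite -(scale0r 0) homJ// mul0r.
have pu : dot p u = J u.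
  have := up 0; have := up (2 *: u).
  by rewrite homJ// !dotDr !dotNr dotZr J0 -(scale0r u) dotZr; lra.
by split=> // w; move: (up w); rewrite dotDr dotNr pu; lra.
Qed.

(** Both [dot p x <= J x] and [dot p y <= J y] hold, and their sum is an
    equality, hence so is each. *)
Lemma subdifferential_summand x y p : J (x + y) = J x + J y ->
  subdifferential J (x + y) p -> subdifferential J x p.
Proof.
move=> Jxy /subdifferential_homP[]; rewrite dotDr Jxy => pxy pw.
apply/subdifferential_homP; split=> //; apply/eqP; rewrite eq_le pw /=.
by have := pw y; lra.
Qed.

Lemma subdifferential_scale a u p : 0 < a ->
  subdifferential J (a *: u) p <-> subdifferential J u p.
Proof.
move=> a0; split=> /subdifferential_homP[pu pw]; apply/subdifferential_homP.
  split=> //; apply: (@mulfI _ a); first by rewrite gt_eqF.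
  by rewrite -dotZr pu homJ// ltW.
by split=> //; rewrite dotZr pu homJ// ltW.
Qed.

Hypothesis subaddJ : forall x y, J (x + y) <= J x + J y.

(** An almost-everywhere inclusion only provides points accumulating at [b];
    subadditivity gives the one-sided continuity that carries it to [b]. *)
Lemma subdifferential_limit_segment c d p (a b : R) : a < b ->
  (forall e, a <= e < b -> exists2 s, e < s < b &
     subdifferential J (c + s *: d) p) ->
  subdifferential J (c + b *: d) p.
Proof.
move=> ab dense; apply/subdifferential_homP.
have [|s0 _ /subdifferential_homP[_ pw]] := dense a; first by rewrite lexx.
split=> //; apply/eqP; rewrite eq_le pw/= leNgt; apply/negP => gap.
pose delta := J (c + b *: d) - dot p (c + b *: d).
have delta0 : 0 < delta by rewrite subr_gt0.
(* The [+ 1] only makes the divisor [M] positive. *)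
pose M := J d - dot p d + 1.
have M0 : 0 < M by rewrite ltr_wpDl// subr_ge0.
(* The defect [delta] at [b] is at most [(b - s) * M]; [s] is taken so
   close to [b] that this is less than [delta]. *)
have [|s /andP[+ sb] /subdifferential_homP[+ _]] :=
    dense (Num.max a (b - delta / M)).
  by rewrite le_max lexx gt_max ab gtrBl divr_gt0.
rewrite gt_max ltrBlDr -ltrBlDl ltr_pdivlMr// => /andP[_].
have : J (c + b *: d) <= J (c + s *: d) + (b - s) * J d.
  rewrite -homJ; last by rewrite subr_ge0 ltW.
  apply: le_trans (subaddJ _ _).
  by rewrite -addrA -scalerDl [s + _]addrC subrK.
by rewrite /delta /M !dotDr !dotZr; nra.
Qed.

End Subdifferential.

(** * The functional [u |-> |K u|_1] and diagonal dominance *)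

Section L1.
Context {R : realType} {m n : nat} (K : 'M[R]_(m, n)).
Implicit Types p u x y : 'cV[R]_n.
Let J u := l1norm (K *m u).

Lemma l1norm_mul_homog a u : 0 <= a -> J (a *: u) = a * J u.
Proof.
move=> a0; rewrite /J /l1norm mulr_sumr; apply: eq_bigr => i _.
by rewrite -scalemxAr mxE normrM ger0_norm.
Qed.

Lemma l1norm_mul_subadd x y : J (x + y) <= J x + J y.
Proof.
rewrite /J /l1norm -big_split; apply: ler_sum => i _.
by rewrite mulmxDr mxE ler_normD.
Qed.

(** The entries of [K x] and [K y] never have opposite signs, so the triangle
    inequality is an equality entry by entry. *)
Lemma l1norm_mul_add x y : (forall l, 0 <= (K *m x) l 0 * (K *m y) l 0) ->
  J (x + y) = J x + J y.
Proof.
move=> xy; rewrite /J /l1norm -big_split; apply: eq_bigr => l _.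
rewrite mulmxDr mxE; have := xy l.
move: ((K *m x) l 0) ((K *m y) l 0) => a b ab.
have [a0|a0|a0] := ltgtP 0 a.
- have b0 : 0 <= b by rewrite pmulr_rge0 in ab.
  have {}a0 := ltW a0.
  by rewrite !ger0_norm// addr_ge0.
- have b0 : b <= 0 by rewrite nmulr_rge0 in ab.
  have {}a0 := ltW a0.
  by rewrite !ler0_norm ?opprD// -oppr_ge0 opprD addr_ge0// oppr_ge0.
- by rewrite -a0 add0r normr0 [RHS]add0r.
Qed.

(** The subgradient inequality is tested at [u + k K^T e_l], where [k] has the
    sign opposite to that of [(K u)_l].  This adds [k] times the [l]-th column
    of [K K^T] to [K u]: the diagonal entry shrinks [|(K u)_l|], and by
    dominance and symmetry the other entries grow by no more in total. *)
Lemma subdifferential_sign_descent u p l : diagonally_dominant (K *m K^T) ->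
  subdifferential J u p -> 0 <= (K *m u) l 0 * (K *m p) l 0.
Proof.
move=> dd up; set A := K *m K^T in dd; set w := K *m u.
have All : 0 <= A l l.
  by rewrite mxE sumr_ge0// => i _; rewrite mxE -expr2 sqr_ge0.
have symA j : A j l = A l j.
  by rewrite !mxE; apply: eq_bigr => i _; rewrite !mxE mulrC.
(* The step is short enough for [(K u)_l] not to cross zero: this needs
   [e * A l l <= 1]. *)
pose e := (A l l + 1)^-1.
have e0 : 0 < e by rewrite invr_gt0 ltr_wpDl.
have eA : e * A l l <= 1 by rewrite ler_pdivrMl ?ltr_wpDl// mulr1 lerDl.
pose k := - (e * w l 0).
have := up (u + k *: col l K^T).
rewrite [u + _]addrC addrK dotZr.
have -> : dot p (col l K^T) = (K *m p) l 0.
  by rewrite mxE; apply: eq_bigr => i _; rewrite !mxE mulrC.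
suff Jz : J (k *: col l K^T + u) <= J u.
  move=> /le_trans/(_ Jz); rewrite gerDl /k mulNr oppr_le0 -mulrA.
  by rewrite pmulr_rge0.
have Kz j : (K *m (k *: col l K^T + u)) j 0 = k * A j l + w j 0.
  rewrite mulmxDr mxE -scalemxAr mxE; congr (_ * _ + _).
  by rewrite !mxE; apply: eq_bigr => i _; rewrite !mxE.
rewrite /J /l1norm (bigD1 l)//= Kz [leRHS](bigD1 l)//= -/w.
have -> : k * A l l + w l 0 = (1 - e * A l l) * w l 0 by rewrite /k; ring.
rewrite normrM ger0_norm ?subr_ge0//.
have sumle : \sum_(j < m | j != l) `|(K *m (k *: col l K^T + u)) j 0| <=
    `|k| * (\sum_(j < m | j != l) `|A l j|) + \sum_(j < m | j != l) `|w j 0|.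
  rewrite mulr_sumr -big_split; apply: ler_sum => j _.
  by rewrite Kz symA -normrM ler_normD.
have kE : `|k| = e * `|w l 0| by rewrite normrN normrM gtr0_norm.
have := ler_wpM2l (normr_ge0 k) (dd l).
rewrite [`|A l l|]ger0_norm// kE; rewrite kE in sumle.
move: sumle; lra.
Qed.

End L1.

(** * Real analysis: null sets, breaks, derivatives *)

Section Analysis.
Context {R : realType}.

Lemma ae_exists_itv (P : R -> Prop) (a b : R) :
  {ae (@lebesgue_measure R), forall t, P t} -> a < b ->
  exists2 t, a < t < b & P t.
Proof.
move=> [A [mA A0 PA]] ab; apply: contrapT => nP.
have abA : [set` `]a, b[] `<=` A.
  move=> t /=; rewrite in_itv/= => tab; apply: PA => /= Pt.
  by apply: nP; exists t.
have := lebesgue_measure_itv `]a, b[.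
rewrite /= lte_fin ab -EFinB => mab.
have : (lebesgue_measure [set` `]a, b[] <= lebesgue_measure A)%E.
  by apply: le_measure => //; rewrite inE.
by rewrite mab A0 lee_fin subr_le0 leNgt ab.
Qed.

Lemma finite_gap (s : seq R) t :
  exists2 e, 0 < e & forall x, x \in s -> x != t -> e <= `|x - t|.
Proof.
elim: s => [|y s [e e0 es]]; first by exists 1.
have [->|yt] := eqVneq y t.
  exists e => // x; rewrite inE => /orP[/eqP->|]; first by rewrite eqxx.
  exact: es.
exists (Num.min e `|y - t|) => [|x].
  by rewrite lt_min e0 normr_gt0 subr_eq0.
rewrite inE ge_min => /orP[/eqP-> _|xs xt]; first by rewrite lexx orbT.
by rewrite es.
Qed.

Definition break_free (s : seq R) (a b : R) :=
  forall x, x \in s -> x \notin `]a, b[.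

(** Every interval is a concatenation of break-free ones.  The induction
    removes one break at a time: a transitive relation that holds on the
    intervals avoiding [y :: s] holds on those avoiding [s], by cutting at
    [y]. *)
Lemma break_free_concat (s : seq R) (P : R -> R -> Prop) :
  (forall a b, 0 <= a -> a < b -> break_free s a b -> P a b) ->
  (forall a b c, a < b -> b < c -> P a b -> P b c -> P a c) ->
  forall a b, 0 <= a -> a < b -> P a b.
Proof.
elim: s => [|y s IHs] Pfree Pcat; first by move=> a b a0 ab; exact: Pfree.
apply: IHs => // a b a0 ab free.
have [yab|yab] := boolP (y \in `]a, b[); last first.
  by apply: Pfree => // x; rewrite inE => /orP[/eqP->//|]; exact: free.
have := yab; rewrite in_itv/= => /andP[ay yb].
have sub c d : a <= c -> d <= b -> y \notin `]c, d[ -> break_free (y :: s) c d.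
  move=> ac db ycd x; rewrite inE => /orP[/eqP->//|/free].
  apply: contra; rewrite !in_itv/= => /andP[cx xd].
  by rewrite (le_lt_trans ac cx) (lt_le_trans xd db).
apply: (Pcat a y b) => //; apply: Pfree => //.
- by apply: sub; rewrite ?(ltW yb)// in_itv/= ltxx andbF.
- by rewrite (le_trans a0)// ltW.
- by apply: sub; rewrite ?(ltW ay)// in_itv/= ltxx.
Qed.

Lemma is_derive_affine n (c d : 'cV[R]_n) (t : R) :
  is_derive t 1 (fun s => c + s *: d) d.
Proof.
have dZ : is_derive t (1 : R) ( *:%R^~ d) d.
  have /= dd := is_diff_scalel t d.
  apply: DeriveDef; first exact/diff_derivable/ex_diff.
  by rewrite deriveE ?diff_val ?scale1r//; exact: ex_diff.
have := is_deriveD (is_derive_cst c t 1) dZ.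
by rewrite add0r.
Qed.

Lemma mx_norm_le n (x : 'cV[R]_n) M :
  0 <= M -> (forall i, `|x i 0| <= M) -> `|x| <= M.
Proof.
move=> M0 xM; rewrite [leLHS]/Num.Def.normr/= mx_normrE bigmax_le//= => -[i j] _.
by rewrite ord1.
Qed.

Lemma derivable_mul_id n (v : R -> 'cV[R]_n) t :
  derivable v t 1 -> derivable (fun s : R => s *: v s) t 1.
Proof.
move=> /derivable_mxP dv; apply/derivable_mxP => i j.
rewrite (_ : (fun x => _) = (id : R -> R) * (fun x => v x i j)).
  by apply: derivableM => //; exact: derivable_id.
by apply/funext => x; rewrite mxE.
Qed.

(** A derivative that is known to exist can be read off on the left alone. *)
Lemma derive1_left_affine n (w : R -> 'cV[R]_n) c d a t : a < t ->
  (forall s, a <= s <= t -> w s = d + s *: c) -> derivable w t 1 ->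
  derive1 w t = c.
Proof.
move=> at_ wE dw; rewrite derive1E /derive cvg_at_leftE//.
apply: cvg_lim => //; apply: cvg_near_cst.
near=> h.
have h0 : h < 0 by near: h; exact: nbhs_left_lt.
have ah : a - t < h by near: h; apply: nbhs_left_gt; rewrite subr_lt0.
rewrite /= !wE; last 2 first.
- by rewrite lexx ltW.
- by apply/andP; split; rewrite [_ *: _]mulr1; lra.
rewrite opprD addrACA subrr add0r -scalerBl addrK scalerA [_%:A]mulr1.
by rewrite mulVf ?scale1r// lt_eqF.
Unshelve. all: by end_near. Qed.

End Analysis.

(** * Pieces of the gradient flow *)

(** At almost every time of the piece [- d] is the velocity prescribed by the
    flow, hence a subgradient there; the inclusion passes to the right end. *)
Lemma gradient_flow_piece (R : realType) n (J : 'cV[R]_n -> R)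
    (u p : R -> 'cV[R]_n) (c d : 'cV[R]_n) (a b : R) :
  (forall k x, 0 <= k -> J (k *: x) = k * J x) ->
  (forall x y, J (x + y) <= J x + J y) ->
  {ae (@lebesgue_measure R), forall t : R, 0 < t ->
     is_derive t 1 u (- p t) /\ subdifferential J (u t) (p t)} ->
  0 <= a -> a < b -> {in `[a, b], forall t, u t = c + t *: d} ->
  subdifferential J (u b) (- d).
Proof.
move=> homJ subJ flow a0 ab uE.
rewrite uE ?in_itv/= ?lexx ?(ltW ab)//.
apply: (@subdifferential_limit_segment _ _ _ homJ subJ _ _ _ _ _ ab).
move=> e /andP[ae eb].
have [s /andP[es sb] []] := ae_exists_itv flow eb.
  exact: le_lt_trans a0 (le_lt_trans ae es).
move=> us ups; exists s; first by rewrite es.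
have sab : s \in `]a, b[ by rewrite in_itv/= sb (le_lt_trans ae).
rewrite -uE ?subset_itv_oo_cc//.
have pE : is_derive s 1 (fun t : R => c + t *: d) (- p s).
  apply: near_eq_is_derive us; near=> t; apply: uE.
  by apply: subset_itv_oo_cc; near: t; exact: near_in_itvoo.
suff -> : d = - p s by rewrite opprK.
rewrite -(derive_val (is_derive := pE)).
by rewrite (derive_val (is_derive := is_derive_affine c d s)).
Unshelve. all: by end_near. Qed.

Section L1Flow.
Context {R : realType} {m n : nat} (K : 'M[R]_(m, n)).
Let J u := l1norm (K *m u).
Hypothesis dd : diagonally_dominant (K *m K^T).

Let homJ := l1norm_mul_homog K.

Lemma piece_sign (c d : 'cV[R]_n) (b : R) l :
  subdifferential J (c + b *: d) (- d) ->
  (K *m (c + b *: d)) l 0 * (K *m d) l 0 <= 0.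
Proof.
move=> /(subdifferential_sign_descent l dd).
by rewrite mulmxN [in X in _ * X]mxE mulrN oppr_ge0.
Qed.

(** Each entry of [K (c + t d)] approaches zero without crossing it up to
    time [b], so what has been lost between [a] and [b] has the sign of what
    is left at [b]. *)
Lemma subdifferential_nested (c d p : 'cV[R]_n) (a b : R) : a <= b ->
  subdifferential J (c + b *: d) (- d) -> subdifferential J (c + a *: d) p ->
  subdifferential J (c + b *: d) p.
Proof.
move=> ab /piece_sign sgn ap.
apply: (@subdifferential_summand _ _ _ homJ _ ((a - b) *: d)); last first.
  by rewrite -addrA -scalerDl [b + _]addrC subrK.
apply: l1norm_mul_add => l; rewrite -scalemxAr [in X in _ * X]mxE mulrCA.
by apply: mulr_le0 => //; rewrite subr_le0.
Qed.

(** [b (c + t d)] is the sum of [(b - t) c] and [t (c + b d)], and going back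
    in time from [b] to [0] the entries of [K (c + s d)] only move away from
    zero, so the two terms have compatible signs. *)
Lemma subdifferential_intercept (c d p : 'cV[R]_n) (t b : R) : 0 < t < b ->
  subdifferential J (c + b *: d) (- d) -> subdifferential J (c + t *: d) p ->
  subdifferential J c p.
Proof.
move=> /andP[t0 tb] /piece_sign sgn tp.
have b0 : 0 < b := lt_trans t0 tb.
have bt : 0 < b - t by rewrite subr_gt0.
apply/(@subdifferential_scale _ _ _ homJ _ _ _ bt).
apply: (@subdifferential_summand _ _ _ homJ _ (t *: (c + b *: d))); last first.
  have -> : (b - t) *: c + t *: (c + b *: d) = b *: (c + t *: d).
    by rewrite !scalerDr !scalerA addrA -scalerDl subrK mulrC.
  exact/(@subdifferential_scale _ _ _ homJ _ _ _ b0).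
apply: l1norm_mul_add => l; move: (sgn l).
rewrite !mulmxDr -!scalemxAr !mulmxDr -!scalemxAr !mxE.
set x := (\sum_j K l j * c j 0); set y := \sum_j K l j * d j 0.
move=> xy; rewrite mulrACA mulr_ge0//; first by rewrite mulr_ge0 ?ltW.
by have := sqr_ge0 (x + b * y); nra.
Qed.

End L1Flow.

(** * A priori bounds *)

Section Bounds.
Context {R : realType} {n : nat} (J : 'cV[R]_n -> R).
Hypothesis homJ : forall a u, 0 <= a -> J (a *: u) = a * J u.

(** Testing a subgradient with plus and minus the unit vectors bounds its
    entries, independently of the base point. *)
Lemma subdifferential_bounded :
  exists2 M, 0 <= M & forall u p, subdifferential J u p -> `|p| <= M.
Proof.
pose e (i : 'I_n) : 'cV[R]_n := delta_mx i 0.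
pose M := \sum_i (`|J (e i)| + `|J (- e i)|).
have leM i : `|J (e i)| + `|J (- e i)| <= M.
  by rewrite /M (bigD1 i)//= lerDl sumr_ge0// => j _; rewrite addr_ge0.
have M0 : 0 <= M by rewrite sumr_ge0// => j _; rewrite addr_ge0.
exists M => // u p /(subdifferential_homP homJ)[_ pw].
apply: mx_norm_le => // i; apply: le_trans (leM i).
have pe : dot p (e i) = p i 0.
  rewrite /dot (bigD1 i)//= mxE !eqxx mulr1 big1 ?addr0// => j ji.
  by rewrite mxE (negPf ji) mulr0.
have := pw (e i); have := pw (- e i); rewrite dotNr pe.
have := ler_norm (J (e i)); have := ler_norm (J (- e i)).
have := normr_ge0 (J (e i)); have := normr_ge0 (J (- e i)).
by rewrite ler_norml; lra.
Qed.

(** Euler's identity makes [dot (f - u) u] a positive multiple of [J u >= 0],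
    and [2 (dot f u) <= dot f f + dot u u] then bounds [u] by [f]. *)
Lemma proximal_point_bounded f u t : (forall x, 0 <= J x) -> 0 < t ->
  subdifferential J u (t^-1 *: (f - u)) -> `|u| <= Num.sqrt (dot f f).
Proof.
move=> J0 t0 /(subdifferential_homP homJ)[+ _].
rewrite dotZl => pu.
have : 0 <= dot (f - u) u.
  by rewrite -(@pmulr_rge0 _ t^-1) ?invr_gt0// pu.
rewrite dotDl dotNl => fu.
have uf : dot u u <= dot f f.
  have := dot_ge0 (f - u); rewrite !dotDl !dotDr !dotNl !dotNr (dotC u f).
  by move: fu; lra.
apply: mx_norm_le; first exact: sqrtr_ge0.
move=> i; rewrite -sqrtr_sqr ler_wsqrtr//.
exact: le_trans (sqr_entry_le_dot u i) uf.
Qed.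

End Bounds.

Lemma lipschitz_continuous_at {R : realType} n (u : R -> 'cV[R]_n) M t :
  0 <= M -> 0 < t ->
  (forall a b, 0 <= a -> a < b -> `|u a - u b| <= M * (b - a)) ->
  {for t, continuous u}.
Proof.
move=> M0 t0 lip; apply/cvgrPdist_le => e e0.
have M1 : 0 < M + 1 by rewrite ltr_wpDl.
near=> s.
have s0 : 0 < s by near: s; exact: lt_nbhsr.
have st : `|t - s| <= e / (M + 1).
  near: s; apply: cvgr_dist_le; first exact: cvg_id.
  by rewrite divr_gt0.
have {}st : M * `|t - s| <= e.
  move: st; rewrite ler_pdivlMr//; have := normr_ge0 (t - s); lra.
apply: le_trans st.
have [ts|ts|->] := ltgtP t s; last by rewrite !subrr !normr0 mulr0.
- by rewrite (distrC t) gtr0_norm ?subr_gt0// lip// ltW.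
- by rewrite distrC gtr0_norm ?subr_gt0// lip// ltW.
Unshelve. all: by end_near. Qed.

(** * Global properties of the gradient flow *)

Section L1GradientFlow.
Context {R : realType} {m n : nat} (K : 'M[R]_(m, n)) (f : 'cV[R]_n).
Variables u p : R -> 'cV[R]_n.
Let J x := l1norm (K *m x).
Hypothesis dd : diagonally_dominant (K *m K^T).
Hypothesis flow : gradient_flow J f u p.

Let homJ := l1norm_mul_homog K.

Lemma flow_break_free_piece : exists s, forall a b, 0 <= a -> a < b ->
  break_free s a b -> exists c d, {in `[a, b], forall t, u t = c + t *: d} /\
    subdifferential J (u b) (- d).
Proof.
have [[s pieces] _ ae] := flow; exists s => a b a0 ab free.
have [c [d uE]] := pieces a b a0 ab free; exists c, d; split=> //.
exact: (gradient_flow_piece homJ (l1norm_mul_subadd K) ae a0 ab uE).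
Qed.

(** The two properties are chained together: the mean velocity on [[a, x]] is
    a subgradient at [u x] and needs the nesting from [x] to [b] to become one
    at [u b], where it is averaged with the mean velocity on [[x, b]]. *)
Lemma flow_average a b : 0 <= a -> a < b ->
  (forall q, subdifferential J (u a) q -> subdifferential J (u b) q) /\
  (exists2 q, subdifferential J (u b) q & u a - u b = (b - a) *: q).
Proof.
have [s pieces] := flow_break_free_piece.
move: a b; apply: (break_free_concat (s := s)) => [a b a0 ab free|a x b ax xb].
  have [c [d [uE]]] := pieces a b a0 ab free.
  have -> : u a = c + a *: d by rewrite uE// in_itv/= lexx ltW.
  have -> : u b = c + b *: d by rewrite uE// in_itv/= lexx ltW.
  move=> db; split.
    by move=> q; apply: (subdifferential_nested dd _ db); exact: ltW.
  exists (- d) => //.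
  rewrite opprD addrACA subrr add0r -scalerBl -[b - a]opprB.
  by rewrite scalerN scaleNr opprK.
move=> [sub1 [q1 xq1 uax]] [sub2 [q2 bq2 uxb]]; split.
  by move=> q /sub1/sub2.
have ab : 0 < b - a by rewrite subr_gt0 (lt_trans ax).
pose k := (x - a) / (b - a).
exists (k *: q1 + (1 - k) *: q2).
  apply: subdifferential_convex => //; last exact: sub2.
  rewrite /k ler_pdivrMr// mul1r lerD2r (ltW xb) andbT.
  by rewrite divr_ge0// ltW// subr_gt0.
have -> : u a - u b = (u a - u x) + (u x - u b) by rewrite subrKA.
rewrite uax uxb scalerDr !scalerA; congr (_ *: _ + _ *: _).
  by rewrite /k mulrC divfK ?gt_eqF.
rewrite mulrBr mulr1 /k mulrC divfK ?gt_eqF//; ring.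
Qed.

Lemma flow_average_subgradient t : 0 < t ->
  subdifferential J (u t) (t^-1 *: (f - u t)).
Proof.
move=> t0; have [_ [q qt]] := flow_average (lexx 0) t0.
have [_ -> _] := flow.
by rewrite subr0 => ->; rewrite scalerA mulVf ?scale1r// gt_eqF.
Qed.

(** The piece must extend strictly beyond [t], since the second decomposition
    of [J] uses its right end; starting it at [t] covers the times [t] that
    are breaks but at which the flow happens to be differentiable. *)
Lemma flow_right_piece t : 0 < t -> exists c d b, [/\ t < b,
  {in `[t, b], forall s, u s = c + s *: d} &
  subdifferential J c (t^-1 *: (f - u t))].
Proof.
move=> t0; have [s pieces] := flow_break_free_piece.
have [e e0 gap] := finite_gap s t.
have te : t < t + e by rewrite ltrDl.
have [||c [d [uE db]]] := pieces _ _ _ te; first exact: ltW.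
  move=> x xs; rewrite in_itv/=; apply/negP => /andP[tx xe].
  have := gap x xs (negbT (gt_eqF tx)).
  by rewrite gtr0_norm ?subr_gt0// leNgt ltrBlDl xe.
exists c, d, (t + e); split=> //.
apply: (@subdifferential_intercept _ _ _ _ dd c d _ t (t + e)).
- by rewrite t0.
- by rewrite -uE// in_itv/= lexx ltW.
- rewrite -uE ?in_itv/= ?lexx ?ltW//.
  exact: flow_average_subgradient.
Qed.

Lemma flow_lipschitz : exists2 M, 0 <= M &
  forall a b, 0 <= a -> a < b -> `|u a - u b| <= M * (b - a).
Proof.
have [M M0 qM] := subdifferential_bounded homJ; exists M => // a b a0 ab.
have [_ [q qb ->]] := flow_average a0 ab.
rewrite normrZ gtr0_norm ?subr_gt0// mulrC ler_wpM2r ?(qM _ _ qb)//.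
by rewrite subr_ge0 ltW.
Qed.

Lemma flow_continuous t : 0 < t -> {for t, continuous u}.
Proof.
move=> t0; have [M M0 lip] := flow_lipschitz.
exact: lipschitz_continuous_at lip.
Qed.

Lemma finite_breaks : finite_set
  [set tau : R | 0 < tau /\ ~ derivable (fun tau : R => u tau^-1) tau 1].
Proof.
(* The exceptional points are among the inverses of the breaks. *)
have [s pieces] := flow_break_free_piece.
apply: (@sub_finite_set _ _ [set` map GRing.inv s]); last exact: finite_seq.
move=> tau [tau0 ntau] /=; apply: contrapT => tau_s; apply: ntau.
have {}tau_s : tau^-1 \notin s.
  apply/negP => ts; apply: tau_s; apply/mapP; exists tau^-1 => //.
  by rewrite invrK.
set t := tau^-1 in tau_s.
have t0 : 0 < t by rewrite invr_gt0.
have [e e0 gap] := finite_gap s t.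
pose a := Num.max 0 (t - e).
have a0 : 0 <= a by rewrite le_max lexx.
have at_ : a < t by rewrite gt_max t0 gtrBl.
have te : t < t + e by rewrite ltrDl.
have [||c [d [uE _]]] := pieces a (t + e) a0; first exact: lt_trans te.
  move=> x xs; rewrite in_itv/= gt_max -andbA; apply/negP => /and3P[_ ex xe].
  have := gap x xs; have [xt|_ /(_ isT)] := eqVneq x t.
    by rewrite -xt xs in tau_s.
  by rewrite leNgt ltr_norml ltrBlDl xe andbT ltrBrDl ex.
have dv : derivable (fun x : R => c + x^-1 *: d) tau 1.
  apply/derivable_mxP => i j.
  rewrite (_ : (fun x => _) = cst (c i j) + (fun x : R => x^-1) * cst (d i j)).
    apply: derivableD; first exact: derivable_cst.
    apply: derivableM; last exact: derivable_cst.
    by apply: derivableV => //; rewrite gt_eqF.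
  by apply/funext => x; rewrite !mxE.
have tI : t \in `]a, t + e[ by rewrite in_itv/= at_ te.
have nearI : \forall x \near tau, x^-1 \in `]a, t + e[.
  exact: (inv_continuous (lt0r_neq0 tau0)) (near_in_itvoo tI).
apply: near_eq_derivable dv; near=> x.
by rewrite uE//; apply: subset_itv_oo_cc; near: x.
Unshelve. all: by end_near. Qed.

End L1GradientFlow.

(** * The inverse scale space flow *)

Theorem theorem8 (R : realType) (m n : nat) (K : 'M[R]_(m, n)) (f : 'cV[R]_n)
    (uGF pGF uVM : R -> 'cV[R]_n) :
  let J : 'cV[R]_n -> R := fun u => l1norm (K *m u) in
  let pVM : R -> 'cV[R]_n := fun t => t^-1 *: (f - uVM t) in
  let v : R -> 'cV[R]_n := fun tau => uGF tau^-1 in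
  let r : R -> 'cV[R]_n := fun tau => pVM tau^-1 in
  let tv : R -> 'cV[R]_n := fun tau => tau *: v tau in
  let D : set R := [set tau | 0 < tau /\ ~ derivable v tau 1] in
  diagonally_dominant (K *m K^T) ->
  gradient_flow J f uGF pGF ->
  variational_method J f uVM ->
  [/\ finite_set D,
      (forall tau : R, 0 < tau -> ~ D tau ->
        [/\ derivable tv tau 1,
            derivable r tau 1,
            derive1 r tau = f - derive1 tv tau &
            subdifferential J (derive1 tv tau) (r tau)]) &
      inverse_scale_space_flow J f D r (derive1 tv)].
Proof.
move=> J pVM v r tv D dd flow vm.
have avg (t : R) : 0 < t -> subdifferential J (uGF t) (t^-1 *: (f - uGF t)).
  exact: flow_average_subgradient dd flow t.
have vmE (t : R) : 0 < t -> uVM t = uGF t.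
  move=> t0; apply: (proximal_point_unique t0 (avg t t0)).
  exact: (vm t t0 (uGF t)).
have rE (tau : R) : 0 < tau -> r tau = tau *: (f - v tau).
  by move=> tau0; rewrite /r /pVM vmE ?invr_gt0// invrK.
have near_rE (tau : R) : 0 < tau -> \forall x \near tau, x *: (f - v x) = r x.
  by move=> tau0; near=> x; rewrite rE//; near: x; exact: lt_nbhsr.
have dtv (tau : R) : 0 < tau -> ~ D tau -> derivable tv tau 1.
  move=> tau0 nD; apply: derivable_mul_id; apply: contrapT => ndv.
  exact: nD (conj tau0 ndv).
have dr (tau : R) : 0 < tau -> ~ D tau ->
    is_derive tau 1 r (f - derive1 tv tau).
  move=> tau0 nD; apply: (near_eq_is_derive (near_rE _ tau0)).
  rewrite (_ : (fun x => _) = (fun x : R => 0 + x *: f) - tv).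
    apply: is_deriveB; first exact: is_derive_affine.
    by rewrite derive1E; apply: derivableP; exact: dtv.
  by apply/funext => x; rewrite scalerBr !fctE add0r.
have sub (tau : R) : 0 < tau -> ~ D tau ->
    subdifferential J (derive1 tv tau) (r tau).
  move=> tau0 nD; have t0 : 0 < tau^-1 by rewrite invr_gt0.
  have [c [d [b [tb uE]]]] := flow_right_piece dd flow t0.
  rewrite /r /pVM vmE//.
  suff -> : derive1 tv tau = c by [].
  have b0 := lt_trans t0 tb.
  (* For [s] slightly less than [tau], [1 / s] is in the piece right of
     [1 / tau]. *)
  apply: (@derive1_left_affine _ _ _ _ d b^-1) (dtv _ tau0 nD).
    by rewrite -ltf_pV2 ?posrE ?invr_gt0// invrK.
  move=> s /andP[bs st]; have s0 : 0 < s by rewrite (lt_le_trans _ bs)// invr_gt0.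
  rewrite /tv /v uE; last first.
    by rewrite in_itv/= lef_pV2 ?posrE// st -lef_pV2 ?posrE ?invr_gt0// invrK.
  by rewrite scalerDr scalerA mulfV ?scale1r 1?addrC// gt_eqF.
have finD : finite_set D by exact: finite_breaks flow.
split; first exact: finD.
  move=> tau tau0 nD; have [drt drE] := dr tau tau0 nD.
  split; [exact: dtv|exact: drt| |exact: sub].
  by rewrite derive1E drE.
split; first exact: finD.
- move=> s s0; change (r x @[x --> s] --> r s); rewrite rE//.
  apply: cvg_trans; first exact: near_eq_cvg (near_rE _ s0).
  apply: cvgZ; first exact: cvg_id.
  apply: cvgB; first exact: cvg_cst.
  have invs : (x : R)^-1 @[x --> s] --> s^-1.
    by apply: inv_continuous; rewrite gt_eqF.
  have uc : uGF x @[x --> s^-1] --> uGF s^-1.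
    by apply: (flow_continuous dd flow); rewrite invr_gt0.
  exact: cvg_comp invs uc.
(* [B] bounds [f - v s]; the [+ 1] makes it a valid divisor. *)
- pose B := `|f| + Num.sqrt (dot f f) + 1.
  have B0 : 0 < B by rewrite ltr_wpDl// addr_ge0// sqrtr_ge0.
  have J0 x : 0 <= J x by rewrite sumr_ge0.
  apply/cvgrPdist_le => e e0; near=> s.
  have s0 : 0 < s by near: s; exact: nbhs_right_gt.
  have sB : s * B <= e.
    rewrite -ler_pdivlMr//; near: s; apply: nbhs_right_le; exact: divr_gt0.
  rewrite sub0r normrN rE// normrZ gtr0_norm//; apply: le_trans sB.
  rewrite ler_pM2l// (le_trans (ler_normB _ _))// /B -addrA lerD2l.
  rewrite ler_wpDr//; have t0 : 0 < s^-1 by rewrite invr_gt0.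
  exact: (proximal_point_bounded (l1norm_mul_homog K) J0 t0 (avg _ t0)).
- by move=> s s0 nD; split; [exact: dr|exact: sub].
Unshelve. all: by end_near. Qed.
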